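(* Fix a standard Young tableau $T$ of shape $\lambda\vdash k$. For $n\ge 1$ let $N(n;T)$ be the number of standard Young tableaux with $n$ cells that contain $T$ as a subtableau, and let $t_n$ be the number of all standard Young tableaux with $n$ cells (of any shape). Then \[\lim_{n\to\infty}\frac{N(n;T)}{t_n}=\frac{f^{\lambda}}{k!},\] where $f^\lambda$ is the number of standard Young tableaux of shape $\lambda$.
   Context: A standard Young tableau with $n$ cells is a Ferrers diagram of some partition of $n$ filled bijectively with $1,2,\dots,n$ so that entries increase along rows and down columns. For a standard Young tableau $U$ with $n$ cells and $k\le n$, the subtableau of $U$ in the letters $1,\dots,k$ is the tableau formed by the cells of $U$ containing $1,2,\dots,k$ (with those entries); $U$ contains $T$ as a subtableau if $T$ equals the subtableau of $U$ in the letters $1,\dots,|T|$. *)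

(* Defs.v *)
From HB Require Import structures.
From mathcomp Require Import all_boot all_order all_algebra.
From mathcomp Require Import all_classical all_reals all_analysis.
Set Implicit Arguments. Unset Strict Implicit. Unset Printing Implicit Defensive.

(* A filling with n cells is encoded by f : 'I_n -> 'I_n * 'I_n, where
   f i = (row, column) (0-based) of the cell containing the letter i+1.
   Every cell of a diagram with n cells has row, column < n. *)
Definition filling (n : nat) := {ffun 'I_n -> 'I_n * 'I_n}.

Definition row n (f : filling n) (i : 'I_n) : nat := (f i).1.
Definition col n (f : filling n) (i : 'I_n) : nat := (f i).2.

Definition is_syt n (f : filling n) : bool :=
  [&& injectiveb f,
      [forall i, forall r : 'I_n, forall c : 'I_n,
         ((r <= row f i) && (c <= col f i)) ==> [exists j, f j == (r, c)]],
      [forall i, forall j,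
         ((row f i == row f j) && ((col f i).+1 == col f j)) ==> (i < j)]
    & [forall i, forall j,
         (((row f i).+1 == row f j) && (col f i == col f j)) ==> (i < j)]].

Definition shape n (f : filling n) : {set 'I_n * 'I_n} := f @: setT.

Definition contains n k (U : filling n) (T : filling k) : bool :=
  (k <= n) && [forall i : 'I_n, forall j : 'I_k,
     (i == j :> nat) ==> ((row U i == row T j) && (col U i == col T j))].

Definition Ncount k (T : filling k) (n : nat) : nat :=
  #|[set U : filling n | is_syt U && contains U T]|.

Definition tcount (n : nat) : nat := #|[set U : filling n | is_syt U]|.

Definition flambda k (T : filling k) : nat :=
  #|[set S : filling k | is_syt S && (shape S == shape T)]|.

(* Main.v *)
(* Read letter by letter, a standard tableau is a walk in the Young lattice, so
   N(n; T) is the number of upward walks of length m = n - k from lambda.  The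
   relation DU = UD + I shows that the number g_m(lambda) of such walks satisfies
     g_(m+1)(lambda) = g_m(lambda) + m g_(m-1)(lambda) + sum_(nu < lambda) g_m(nu),
   nu ranging over the partitions covered by lambda, whence
     g_m(lambda) = sum_j C(m, j) t_(m-j) d_j(lambda),
   where d_j counts the downward walks of length j and t_n solves
   t_(n+1) = t_n + n t_(n-1).  Since t_n / t_(n+1) -> 0 and
   (n+1) t_n / t_(n+2) -> 1, only the term j = k survives after division by t_n,
   and d_k(lambda) = f^lambda. *)
Require Import Defs.
From HB Require Import structures.
From mathcomp Require Import all_boot all_order all_algebra.
From mathcomp Require Import all_classical all_reals all_analysis.
From mathcomp Require Import zify ring lra.
Import Order.TTheory GRing.Theory Num.Theory.
Import numFieldNormedType.Exports.
Set Implicit Arguments. Unset Strict Implicit. Unset Printing Implicit Defensive.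

(** * Walks in the Young lattice *)

Section Walks.
Variables (S : Type) (ok : S -> nat -> bool) (step : S -> nat -> S).

(** Abstract in [ok] and [step], so that growing and shrinking partitions share one theory. A walk
    is recorded by its moves, not by the states visited. *)
Fixpoint walk s w := if w is i :: w' then ok s i && walk (step s i) w' else true.

Fixpoint walks b m s : seq (seq nat) :=
  if m is m'.+1 then
    [seq i :: w | i <- [seq i <- iota 0 b | ok s i], w <- walks b m' (step s i)]
  else [:: [::]].

Lemma mem_walks b m s w :
  (w \in walks b m s) = [&& size w == m, all (fun i => i < b) w & walk s w].
Proof.
elim: m s w => [|m IH] s [|i w] //=.
  by apply/allpairsPdep => -[? [? []]].
rewrite eqSS; apply/allpairsPdep/idP => [[j [v [+ + [-> ->]]]]|].
  by rewrite mem_filter mem_iota IH => /andP[-> /= ->] /and3P[-> -> ->].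
move=> /and3P[sw /andP[ib ab] /andP[oi wi]].
by exists i, w; rewrite mem_filter mem_iota oi ib IH sw ab wi.
Qed.

Lemma uniq_walks b m s : uniq (walks b m s).
Proof.
elim: m s => [|m IH] s //=.
apply: allpairs_uniq_dep => [|i _|[i v] [j w] _ _ /= [-> ->]] //.
exact/filter_uniq/iota_uniq.
Qed.

Lemma size_walksS b m s :
  size (walks b m.+1 s) = \sum_(i < b | ok s i) size (walks b m (step s i)).
Proof.
rewrite /= size_allpairs_dep sumnE big_map big_filter.
by rewrite -[b in iota 0 b]subn0 big_mkord.
Qed.

Lemma walk_cat s v w : walk s (v ++ w) = walk s v && walk (foldl step s v) w.
Proof. by elim: v s => //= i v IH s; rewrite IH andbA. Qed.

Lemma walk_rcons s w i : walk s (rcons w i) = walk s w && ok (foldl step s w) i.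
Proof. by rewrite -cats1 walk_cat /= andbT. Qed.

Lemma walkP s w :
  reflect (forall t, t < size w -> ok (foldl step s (take t w)) (nth 0 w t)) (walk s w).
Proof.
elim/last_ind: w => [|w i IH]; first exact: ReflectT.
rewrite walk_rcons; apply: (iffP andP) => [[/IH wP oi] t|wP].
  rewrite size_rcons ltnS leq_eqVlt nth_rcons => /predU1P[->|lt].
    by rewrite ltnn eqxx -cats1 take_size_cat.
  by rewrite lt -cats1 takel_cat 1?ltnW //; apply: wP.
split.
  apply/IH => t lt; have := wP t; rewrite size_rcons nth_rcons lt ltnS ltnW//.
  by rewrite -cats1 takel_cat 1?ltnW //; apply.
have := wP (size w); rewrite size_rcons nth_rcons ltnn eqxx -cats1 take_size_cat//.
exact.
Qed.

End Walks.

(* A partition is encoded by its row lengths; the bound b on the rows in which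
   cells are added or removed only serves to keep the sums finite. *)
Definition partition_fun (l : nat -> nat) := forall i, l i.+1 <= l i.
Definition addable (l : nat -> nat) i := if i is j.+1 then l j.+1 < l j else true.
Definition removable (l : nat -> nat) i := l i.+1 < l i.
Definition add_cell (l : nat -> nat) i := fun r => l r + (r == i).
Definition del_cell (l : nat -> nat) i := fun r => l r - (r == i).

Definition up_count b m l := size (walks addable add_cell b m l).
Definition down_count b m l := size (walks removable del_cell b m l).

Lemma up_countS b m l :
  up_count b m.+1 l = \sum_(i < b | addable l i) up_count b m (add_cell l i).
Proof. exact: size_walksS. Qed.

Lemma down_countS b m l :
  down_count b m.+1 l = \sum_(i < b | removable l i) down_count b m (del_cell l i).
Proof. exact: size_walksS. Qed.

Lemma partition_add l i :
  partition_fun l -> addable l i -> partition_fun (add_cell l i).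
Proof.
move=> pl ai r; have := pl r; rewrite /add_cell.
by have [e|] := eqVneq r.+1 i; [move: ai; rewrite -e /=; lia|lia].
Qed.

Lemma partition_del l i :
  partition_fun l -> removable l i -> partition_fun (del_cell l i).
Proof.
move=> pl; rewrite /removable => ai r; have := pl r; rewrite /del_cell.
by have [->|] := eqVneq r i; lia.
Qed.

Lemma del_addK l i : del_cell (add_cell l i) i = l.
Proof. by apply/funext => r; rewrite /del_cell /add_cell addnK. Qed.

Lemma add_delK l i : removable l i -> add_cell (del_cell l i) i = l.
Proof.
move=> ri; apply/funext => r; rewrite /del_cell /add_cell subnK //.
by case: eqP => // ->; move: ri; rewrite /removable; lia.
Qed.

Lemma del_add_comm l i j :
  i != j -> del_cell (add_cell l i) j = add_cell (del_cell l j) i.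
Proof. by move=> ij; apply/funext => r; rewrite /del_cell /add_cell; lia. Qed.

Lemma addable_removable_comm l i j : partition_fun l -> i != j ->
  addable l i && removable (add_cell l i) j =
  removable l j && addable (del_cell l j) i.
Proof.
move=> pl; rewrite /removable /addable /add_cell /del_cell.
have := pl j; case: i => [|i]; first by lia.
by have [->|] := eqVneq i j; lia.
Qed.

Lemma addable_del l i :
  partition_fun l -> removable l i -> addable (del_cell l i) i.
Proof.
rewrite /removable /addable /del_cell; case: i => // i pl.
by have := pl i; lia.
Qed.

Lemma removable_add l i : partition_fun l -> removable (add_cell l i) i.
Proof. by move=> pl; rewrite /removable /add_cell; have := pl i; lia. Qed.

(** A cell can be added in row [i.+1] exactly when one can be removed from row [i], so row 0
    accounts for one extra addable corner; [l b = 0] excludes a removal from row [b]. *)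
Lemma sum_addable b l (c : nat) : l b = 0 ->
  \sum_(i < b.+1 | addable l i) c = c + \sum_(i < b.+1 | removable l i) c.
Proof.
move=> lb; rewrite big_mkcond big_ord_recl /=; congr (_ + _).
rewrite big_mkcond [RHS]big_mkcond big_ord_recr /= {2}/removable lb /= addn0.
by apply: eq_bigr => i _.
Qed.

(* The relation DU = UD + I of the Young lattice, tested against F. *)
Lemma sum_up_down b l (F : (nat -> nat) -> nat) :
  partition_fun l -> l b = 0 ->
  \sum_(i < b.+1 | addable l i)
     \sum_(j < b.+1 | removable (add_cell l i) j) F (del_cell (add_cell l i) j) =
  F l + \sum_(j < b.+1 | removable l j)
     \sum_(i < b.+1 | addable (del_cell l j) i) F (add_cell (del_cell l j) i).
Proof.
move=> pl lb.
(* The diagonal terms [i = j] all equal [F l] and occur once more on the left, by [sum_addable]; the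
   others match because moves in different rows commute. *)
have diagL (i : 'I_b.+1) : addable l i ->
    \sum_(j < b.+1 | removable (add_cell l i) j) F (del_cell (add_cell l i) j) =
    F l + \sum_(j < b.+1 | removable (add_cell l i) j && (j != i))
             F (del_cell (add_cell l i) j).
  by move=> ai; rewrite (bigD1 i) ?del_addK //; exact: removable_add.
have diagR (j : 'I_b.+1) : removable l j ->
    \sum_(i < b.+1 | addable (del_cell l j) i) F (add_cell (del_cell l j) i) =
    F l + \sum_(i < b.+1 | addable (del_cell l j) i && (i != j))
             F (add_cell (del_cell l j) i).
  by move=> rj; rewrite (bigD1 j) ?add_delK //=; exact: addable_del.
rewrite (eq_bigr _ diagL) (eq_bigr _ diagR) !big_split /= (sum_addable _ lb).
rewrite -addnA; congr (_ + (_ + _)).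
under eq_bigr do rewrite big_mkcondr.
under [RHS]eq_bigr do rewrite big_mkcondr.
rewrite !pair_big_dep /= [RHS](reindex_inj (h := fun p => (p.2, p.1)))/=; last first.
  by move=> [? ?] [? ?] [-> ->].
rewrite -!big_mkcondr; apply: eq_big => [[i j]|[i j]] /=.
  case: (eqVneq i j) => [->|ij]; first by rewrite !andbF.
  by rewrite !andbT addable_removable_comm.
by rewrite eq_sym => /andP[_ ij]; rewrite del_add_comm.
Qed.

(** Induction on [m]: expand the first step, use the recurrence at each [add_cell l i], and reverse
    the double sum with [sum_up_down], whose extra term raises the coefficient [m] to [m.+1]. The
    vanishing of [l] leaves room for [m.+1] new rows, so [b] cuts off no walk. *)
Lemma up_count_rec b m l : partition_fun l -> m < b ->
  (forall i, b <= i + m.+1 -> l i = 0) ->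
  up_count b m.+1 l = up_count b m l + m * up_count b m.-1 l +
                 \sum_(j < b | removable l j) up_count b m (del_cell l j).
Proof.
case: b => // b; elim: m l => [|m IH] l pl mb l0; rewrite up_countS.
  rewrite /up_count /= mul0n addn0 sum_addable //.
  by apply: l0; rewrite addn1.
have l0b : l b = 0 by apply: l0; lia.
have IHi (i : 'I_b.+1) : addable l i -> up_count b.+1 m.+1 (add_cell l i) =
    up_count b.+1 m (add_cell l i) + m * up_count b.+1 m.-1 (add_cell l i) +
    \sum_(j < b.+1 | removable (add_cell l i) j)
       up_count b.+1 m (del_cell (add_cell l i) j).
  move=> ai; apply: IH; [exact: partition_add|exact: ltnW|move=> r br].
  rewrite /add_cell l0; last by lia.
  case: eqP => //= ri; move: ai; rewrite -ri.
  case: r br {ri} => [|r] br /=; first by lia.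
  by rewrite (l0 r) //; lia.
rewrite (eq_bigr _ IHi) !big_split /= sum_up_down // -big_distrr /=.
have -> : m * \sum_(i < b.+1 | addable l i) up_count b.+1 m.-1 (add_cell l i) =
          m * up_count b.+1 m l.
  by case: m {IH mb l0 IHi} => [|m]; rewrite ?mul0n // up_countS.
under [in RHS]eq_bigr do rewrite up_countS.
by rewrite up_countS mulSn addnA -[_ + _ + up_count _ _ _]addnA [m * _ + _]addnC.
Qed.

(** * Expansion of upward walks in downward walks *)

Lemma sum_del_cell b l i : i < b -> removable l i ->
  \sum_(r < b) l r = (\sum_(r < b) del_cell l i r).+1.
Proof.
move=> ib; rewrite /removable => ri.
rewrite (bigD1 (Ordinal ib)) //= [in RHS](bigD1 (Ordinal ib)) //=.
rewrite -addSn; congr (_ + _); first by rewrite /del_cell eqxx; lia.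
apply: eq_bigr => j; rewrite -val_eqE /= /del_cell => /negPf ->.
by rewrite subn0.
Qed.

Lemma down_count_gt b m (l : nat -> nat) : \sum_(r < b) l r < m -> down_count b m l = 0.
Proof.
elim: m l => // m IH l lm; rewrite down_countS big1 // => i ri.
by apply: IH; move: lm; rewrite (sum_del_cell (ltn_ord i) ri).
Qed.

(** The number of involutions of n letters: the last letter is fixed or swapped with one of the
    others. The default 0 is multiplied by [n'] = 0. *)
Fixpoint involutions n :=
  if n is n'.+1 then
    involutions n' + n' * (if n' is n''.+1 then involutions n'' else 0)
  else 1.

Lemma involutionsS n : involutions n.+1 = involutions n + n * involutions n.-1.
Proof. by case: n. Qed.

Arguments involutions : simpl never.

(** Follows from [up_count_rec] by strong induction. Any [p] above the size of [l] will do, so the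
    same [p] serves after a cell is removed. *)
Lemma up_countE b m (l : nat -> nat) p : partition_fun l -> m <= b ->
  (forall i, b <= i + m -> l i = 0) -> \sum_(r < b) l r < p ->
  up_count b m l = \sum_(j < p) 'C(m, j) * involutions (m - j) * down_count b j l.
Proof.
elim/ltn_ind: m l p => -[|m] IH l p pl mb l0 lp.
  case: p lp => // p _; rewrite big_ord_recl big1 /=; first by rewrite addn0.
  by move=> i _; rewrite /bump bin0n.
rewrite up_count_rec //.
rewrite (IH m (leqnn _) l p) //; [|exact: ltnW|by move=> i bi; apply: l0; lia].
have -> : m * up_count b m.-1 l =
    \sum_(j < p) m * 'C(m.-1, j) * involutions (m.-1 - j) * down_count b j l.
  case: m IH mb l0 => [|m] IH mb l0; first by rewrite mul0n big1.
  rewrite (IH m _ l p) //=; [|by lia|by move=> i bi; apply: l0; lia].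
  by rewrite big_distrr /=; apply: eq_bigr => j _; rewrite !mulnA.
have -> : \sum_(j < b | removable l j) up_count b m (del_cell l j) =
    \sum_(j < p) 'C(m, j) * involutions (m - j) * down_count b j.+1 l.
  under eq_bigr => j rj.
    rewrite (IH m (leqnn _) _ p); first over.
    - exact: partition_del.
    - exact: ltnW.
    - by move=> i bi; rewrite /del_cell l0 //; lia.
    - by move: lp; rewrite (sum_del_cell (ltn_ord j) rj); lia.
  rewrite exchange_big /=; apply: eq_bigr => j _.
  by rewrite -big_distrr /= down_countS.
case: p lp => // p lp.
(* Removing a cell shifts [j] to [j.+1]; the overflowing last term vanishes, since it would remove
   more cells than [l] has. *)
rewrite -big_split /= [X in _ + X]big_ord_recr /= down_count_gt // muln0 addn0.
rewrite !big_ord_recl /= -addnA -big_split /= !bin0 !subn0 involutionsS.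
rewrite !mul1n muln1 -mulnDl; congr (_ + _).
apply: eq_bigr => j _; rewrite /bump /= !add1n subSS binS -!mulnDl; congr (_ * _).
(* For [m <= j] the truncated subtractions are harmless: both binomials with lower index [j.+1] are
   zero. *)
have [jm|mj] := ltnP j m; last first.
  rewrite !(@bin_small _ j.+1) //; last by lia.
  by rewrite !(muln0, mul0n, addn0, add0n).
have -> : involutions (m - j) =
    involutions (m - j.+1) + (m - j.+1) * involutions (m.-1 - j.+1).
  have -> : m - j = (m - j.+1).+1 by lia.
  by rewrite involutionsS; congr (_ + _ * involutions _); lia.
have -> : m * 'C(m.-1, j.+1) = (m - j.+1) * 'C(m, j.+1).
  by case: m jm {IH mb l0} => // m _; rewrite subSS mul_bin_down.
by lia.
Qed.

(** * Tableaux as lattice words *)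

Definition row_count (w : seq nat) : nat -> nat := fun r => count_mem r w.
(** The ballot (Yamanouchi) condition: every prefix has at least as many letters [r] as [r.+1]. *)
Definition lattice w := walk addable add_cell (fun=> 0) w.

Lemma row_count_rcons w i : row_count (rcons w i) = add_cell (row_count w) i.
Proof.
by apply/funext => r; rewrite /row_count -cats1 count_cat /= addn0 /add_cell eq_sym.
Qed.

Lemma foldl_add_cell w : foldl add_cell (fun=> 0) w = row_count w.
Proof. by elim/last_ind: w => // w i IH; rewrite foldl_rcons IH row_count_rcons. Qed.

Lemma lattice_rcons w i : lattice (rcons w i) = lattice w && addable (row_count w) i.
Proof. by rewrite /lattice walk_rcons foldl_add_cell. Qed.

Lemma latticeP w :
  reflect (forall t, t < size w -> addable (row_count (take t w)) (nth 0 w t)) (lattice w).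
Proof.
by apply: (iffP (walkP _ _ _ _)) => H t /H; rewrite foldl_add_cell.
Qed.

Lemma partition_row_count w : lattice w -> partition_fun (row_count w).
Proof.
elim/last_ind: w => // w i IH; rewrite lattice_rcons row_count_rcons => /andP[lw].
exact/partition_add/IH.
Qed.

Lemma row_count_take_le w r s t :
  s <= t -> row_count (take s w) r <= row_count (take t w) r.
Proof.
move=> st; rewrite -(subnKC st) takeD /row_count count_cat; exact: leq_addr.
Qed.

Lemma row_count_take_lt w s t : s < t -> s < size w ->
  row_count (take s w) (nth 0 w s) < row_count (take t w) (nth 0 w s).
Proof.
move=> st sw; apply: leq_trans (row_count_take_le _ _ st).
by rewrite (take_nth 0 sw) row_count_rcons /add_cell eqxx addn1.
Qed.

(** Locates the letter of a word that fills cell [(r, c)]: it is the occurrence of [r] preceded by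
    exactly [c] others. *)
Lemma row_count_occurrence w r c : c < row_count w r ->
  exists2 t, t < size w & nth 0 w t = r /\ row_count (take t w) r = c.
Proof.
elim/last_ind: w => // w i IH; rewrite row_count_rcons /add_cell size_rcons.
have [/IH[t tw [ti tc]] _|wc] := ltnP c (row_count w r).
  exists t; first exact: ltnW.
  by rewrite nth_rcons tw -cats1 takel_cat // ltnW.
case: eqP => [ri|_] cw; last by move: cw; rewrite addn0 ltnNge wc.
exists (size w) => //; rewrite nth_rcons ltnn eqxx -cats1 take_size_cat //.
by split => //; lia.
Qed.

Lemma row_count_gt b w r : all (fun i => i < b) w -> b <= r -> row_count w r = 0.
Proof. by move=> /allP wb br; apply/count_memPn/negP => /wb; rewrite ltnNge br. Qed.

Lemma sum_row_count b w :
  all (fun i => i < b) w -> \sum_(r < b) row_count w r = size w.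
Proof.
elim/last_ind: w => [_|w i IH]; first by rewrite big1.
rewrite all_rcons row_count_rcons size_rcons => /andP[ib /IH <-].
rewrite /add_cell big_split /= -addn1; congr (_ + _).
rewrite (bigD1 (Ordinal ib)) //= eqxx big1 // => r.
by rewrite -val_eqE /= => /negPf ->.
Qed.

(** Undoing the letters from last to first peels cells off the shape; the size condition makes the
    walk end at the empty partition. *)
Lemma walk_down_rev b l w : partition_fun l -> (forall i, b <= i -> l i = 0) ->
    \sum_(r < b) l r = size w ->
  walk removable del_cell l (rev w) <-> lattice w /\ row_count w = l.
Proof.
elim/last_ind: w l => [|w i IH] l pl lb.
  move/eqP; rewrite sum_nat_eq0 => /forallP l0; split => // _; split => //.
  apply/funext => r; rewrite /row_count /=; have [/lb->//|rb] := leqP b r.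
  by have /eqP := l0 (Ordinal rb).
rewrite rev_rcons size_rcons lattice_rcons row_count_rcons /= => sl.
have del (ri : removable l i) :
    walk removable del_cell (del_cell l i) (rev w) <->
    lattice w /\ row_count w = del_cell l i.
  apply: IH; first exact: partition_del.
    by move=> r /lb; rewrite /del_cell => ->.
  have ib : i < b by rewrite ltnNge; apply/negP => /lb; move: ri; rewrite /removable; lia.
  by move: sl; rewrite (sum_del_cell ib ri) => -[].
split=> [/andP[ri /(del ri)[lw cw]]|[/andP[lw aw] cl]].
  by rewrite lw cw add_delK ?addable_del.
have ri : removable l i by rewrite -cl; apply/removable_add/partition_row_count.
by rewrite ri; apply/del => //; rewrite -cl del_addK.
Qed.

Lemma walk_down_bounded b l w : (forall i, b <= i -> l i = 0) ->
  walk removable del_cell l w -> all (fun i => i < b) w.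
Proof.
elim: w l => //= i w IH l lb /andP[ri ww].
have -> : i < b by rewrite ltnNge; apply/negP => /lb; move: ri; rewrite /removable; lia.
by apply: IH ww => r /lb; rewrite /del_cell => ->.
Qed.

(** Cells are only removed from nonempty rows, so enlarging the bound adds no walk. *)
Lemma down_count_widen b b' m l : b <= b' -> (forall i, b <= i -> l i = 0) ->
  down_count b' m l = down_count b m l.
Proof.
move=> bb lb; apply/perm_size/uniq_perm; [exact: uniq_walks|exact: uniq_walks|].
move=> w; rewrite !mem_walks; congr (_ && _); apply/andP/andP => -[_ ww]; split=> //.
  exact: walk_down_bounded ww.
by apply: walk_down_bounded ww => i /(leq_trans bb)/lb.
Qed.

Definition row_word n (f : filling n) : seq nat := [seq Defs.row f i | i <- enum 'I_n].

Lemma size_row_word n (f : filling n) : size (row_word f) = n.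
Proof. by rewrite size_map size_enum_ord. Qed.

Lemma nth_row_word n (f : filling n) (i : 'I_n) : nth 0 (row_word f) i = Defs.row f i.
Proof. by rewrite (nth_map i) ?size_enum_ord // nth_ord_enum. Qed.

Lemma row_word_bounded n (f : filling n) : all (fun i => i < n) (row_word f).
Proof. by apply/allP => _ /mapP[i _ ->]; exact: ltn_ord. Qed.

(** Each row is filled from left to right; a ranked filling is thus determined by its row word. *)
Definition ranked n (f : filling n) :=
  forall i, Defs.col f i = row_count (take i (row_word f)) (Defs.row f i).

Lemma filling_inj n (f : filling n) i j :
  Defs.row f i = Defs.row f j -> Defs.col f i = Defs.col f j -> f i = f j.
Proof.
rewrite /Defs.row /Defs.col => r c; apply/eqP; rewrite -pair_eqE /pair_eq /=.
by rewrite -!val_eqE /= r c !eqxx.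
Qed.

Lemma syt_lattice n (f : filling n) : is_syt f -> lattice (row_word f) /\ ranked f.
Proof.
case/and4P => /injectiveP finj /forallP hdown /forallP hrow /forallP hcol.
have down i r c : r <= Defs.row f i -> c <= Defs.col f i ->
    exists2 j, Defs.row f j = r & Defs.col f j = c.
  move=> ri ci; have rn := leq_ltn_trans ri (ltn_ord _).
  have cn := leq_ltn_trans ci (ltn_ord _).
  have /forallP/(_ (Ordinal rn))/forallP/(_ (Ordinal cn)) := hdown i.
  by rewrite /= ri ci => /existsP[j /eqP fj]; exists j; rewrite /Defs.row /Defs.col fj.
have uni i j : Defs.row f i = Defs.row f j -> Defs.col f i = Defs.col f j -> i = j.
  by move=> r c; exact/finj/filling_inj.
have rowS i j : Defs.row f i = Defs.row f j -> (Defs.col f i).+1 = Defs.col f j -> i < j.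
  by move=> r c; move: (hrow i) => /forallP/(_ j); rewrite r c !eqxx.
have colS i j : (Defs.row f i).+1 = Defs.row f j -> Defs.col f i = Defs.col f j -> i < j.
  by move=> r c; move: (hcol i) => /forallP/(_ j); rewrite r c !eqxx.
(* [is_syt] compares only adjacent cells; the left neighbours supplied by [down] chain these
   comparisons along a row. *)
have rowlt i j : Defs.row f i = Defs.row f j -> Defs.col f i < Defs.col f j -> i < j.
  move: {2}(Defs.col f j) (erefl (Defs.col f j)) => c.
  elim: c j => [|c IH] j cj rij; rewrite cj // ltnS leq_eqVlt => /predU1P[ci|ci].
    by apply: rowS => //; rewrite ci.
  have [j' rj' cj'] := down j (Defs.row f j) c (leqnn _) (ltac:(by rewrite cj)).
  apply: ltn_trans (IH j' cj' _ _) _; rewrite ?cj' ?rj' //.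
  by apply: rowS; rewrite ?cj'.
have occ (i : 'I_n) r c : c < row_count (take i (row_word f)) r ->
    exists j : 'I_n, [/\ j < i, Defs.row f j = r & row_count (take j (row_word f)) r = c].
  move=> /row_count_occurrence[t]; rewrite size_take size_row_word ltn_ord => ti.
  have tn := ltn_trans ti (ltn_ord i).
  rewrite nth_take // (take_takel _ (ltnW ti)) -[t]/(val (Ordinal tn)) nth_row_word.
  by move=> [? ?]; exists (Ordinal tn).
have rk : ranked f.
  move=> i; move: {2}(Defs.col f i) (erefl (Defs.col f i)) => c.
  elim: c i => [|c IH] i ci; rewrite ci; apply/esym/eqP; rewrite eqn_leq.
    rewrite leqNgt andbT; apply/negP => /occ[j [ji rj _]].
    have [cj|] := posnP (Defs.col f j).
      by move: ji; rewrite (uni j i) ?ltnn // cj.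
    by rewrite -ci => /(rowlt i j (esym rj)); rewrite ltnNge ltnW.
  (* The left neighbour [j] of [i] has rank [c]. A larger rank for [i] would give a letter [s] of
     the same row strictly between [j] and [i], and no column is possible for [s]. *)
  have [j rj cj] := down i (Defs.row f i) c (leqnn _) (ltac:(by rewrite ci)).
  have ji : j < i by apply: rowS; rewrite ?cj.
  have jn : j < size (row_word f) by rewrite size_row_word.
  have := row_count_take_lt ji jn; rewrite nth_row_word -IH // cj rj => ->.
  rewrite andbT leqNgt; apply/negP => /occ[s [si rs cs]].
  have js : j < s.
    rewrite ltnNge; apply/negP => /(row_count_take_le (row_word f) (Defs.row f i)).
    by rewrite cs -{1}rj -IH // cj ltnn.
  have [sc|sc|sc] := ltngtP (Defs.col f s) c.
  - by have := rowlt s j (etrans rs (esym rj)); rewrite cj sc => /(_ isT); lia.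
  - have [e|ne] := eqVneq (Defs.col f s) c.+1.
      by move: si; rewrite (uni s i) ?ltnn // ci.
    by have := rowlt i s (esym rs); rewrite ci; lia.
  - by move: js; rewrite (uni s j) ?ltnn // ?cj ?rs.
split=> //; apply/latticeP => t; rewrite size_row_word => tn.
rewrite -[t]/(val (Ordinal tn)) nth_row_word; move: (Ordinal tn) => i.
case ri: (Defs.row f i) => [//|r] /=; rewrite -ri -rk.
(* The cell just above [i] holds an earlier letter; counting it shows that row [r] is still strictly
   longer than row [r.+1] when [i] is placed. *)
have [j rj cj] := down i r (Defs.col f i) (ltac:(by rewrite ri)) (leqnn _).
have ji : j < i by apply: colS; rewrite ?rj.
have jn : j < size (row_word f) by rewrite size_row_word.
by have := row_count_take_lt ji jn; rewrite nth_row_word -rk rj cj.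
Qed.

Lemma lattice_syt n (f : filling n) : lattice (row_word f) -> ranked f -> is_syt f.
Proof.
move=> lw rk.
have iw (i : 'I_n) : i < size (row_word f) by rewrite size_row_word.
have lt i j : Defs.row f i = Defs.row f j -> i < j -> Defs.col f i < Defs.col f j.
  by move=> rij ij; rewrite !rk -rij -nth_row_word; exact: row_count_take_lt.
have le i j : Defs.row f i = Defs.row f j -> i <= j -> Defs.col f i <= Defs.col f j.
  by move=> rij ij; rewrite !rk -rij; exact: row_count_take_le.
have mono i j : i <= j -> row_count (row_word f) j <= row_count (row_word f) i.
  move=> /subnKC <-; elim: (j - i) => [|d IH]; rewrite ?addn0 // addnS.
  exact: leq_trans (partition_row_count lw _) IH.
apply/and4P; split.
- apply/injectiveP => i j fij.
  have r : Defs.row f i = Defs.row f j by rewrite /Defs.row fij.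
  have c : Defs.col f i = Defs.col f j by rewrite /Defs.col fij.
  have [ij|ji|/val_inj//] := ltngtP (i : nat) j.
    by have := lt _ _ r ij; rewrite c ltnn.
  by have := lt _ _ (esym r) ji; rewrite c ltnn.
- apply/forallP => i; apply/forallP => r; apply/forallP => c.
  apply/implyP => /andP[ri ci].
  have : c < row_count (row_word f) r.
    apply: leq_trans (mono _ _ ri); apply: leq_ltn_trans ci _.
    rewrite rk -nth_row_word -[X in _ < row_count X _]take_size.
    by apply: row_count_take_lt; rewrite // size_row_word.
  move=> /row_count_occurrence[t]; rewrite size_row_word => tn.
  rewrite -[t]/(val (Ordinal tn)) nth_row_word => -[rt ct].
  apply/existsP; exists (Ordinal tn); rewrite -pair_eqE /pair_eq -!val_eqE /=.
  by rewrite -/(Defs.row f _) -/(Defs.col f _) rk rt ct !eqxx.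
- apply/forallP => i; apply/forallP => j; apply/implyP => /andP[/eqP r /eqP c].
  by rewrite ltnNge; apply/negP => /(le _ _ (esym r)); rewrite -c ltnn.
apply/forallP => i; apply/forallP => j; apply/implyP => /andP[/eqP r /eqP c].
rewrite ltnNge; apply/negP => /(row_count_take_le (row_word f) (Defs.row f i)).
(* If [j] came no later than [i], row [row f i] would have at most [col f i] cells when [j] is
   placed under [i], against addability. *)
have := latticeP _ lw j (iw j); rewrite nth_row_word -r /= r -!rk -c; lia.
Qed.

(** Inverse of [row_word]. The default [i] of [insubd] is never taken for a word of size [n] with
    letters below [n]. *)
Definition filling_of n (w : seq nat) : filling n :=
  [ffun i : 'I_n =>
     (insubd i (nth 0 w i), insubd i (row_count (take i w) (nth 0 w i)))].

Lemma row_word_filling_of n w : size w = n -> all (fun i => i < n) w ->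
  row_word (filling_of n w) = w.
Proof.
move=> sw /allP wn; apply: (@eq_from_nth _ 0); first by rewrite size_row_word.
move=> t; rewrite size_row_word => tn; rewrite -[t]/(val (Ordinal tn)) nth_row_word.
rewrite /Defs.row ffunE /= insubdK //.
by apply/wn/mem_nth; rewrite sw.
Qed.

Lemma filling_of_ranked n w : size w = n -> all (fun i => i < n) w ->
  ranked (filling_of n w).
Proof.
move=> sw wn i; rewrite -nth_row_word row_word_filling_of // /Defs.col ffunE /= insubdK //.
apply: leq_ltn_trans (ltn_ord i); apply: leq_trans (count_size _ _) _.
by rewrite size_take; case: ifP => // /negbT; rewrite -leqNgt.
Qed.

Lemma filling_of_syt n w : size w = n -> all (fun i => i < n) w ->
  lattice w -> is_syt (filling_of n w).
Proof.
move=> sw wn lw; apply: lattice_syt; last exact: filling_of_ranked.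
by rewrite row_word_filling_of.
Qed.

Lemma row_word_inj n : {in @is_syt n &, injective (@row_word n)}.
Proof.
move=> f g /syt_lattice[_ rf] /syt_lattice[_ rg] fg; apply/ffunP => i.
have r : Defs.row f i = Defs.row g i by rewrite -!nth_row_word fg.
have c : Defs.col f i = Defs.col g i by rewrite rf rg fg r.
rewrite (surjective_pairing (f i)) (surjective_pairing (g i)).
by congr (_, _); apply: val_inj.
Qed.

Lemma mem_shape n (f : filling n) (r c : 'I_n) : ranked f ->
  ((r, c) \in Defs.shape f) = (c < row_count (row_word f) r).
Proof.
move=> rk; apply/imsetP/idP => [[i _ fi]|].
  have -> : r = Defs.row f i :> nat by rewrite /Defs.row -fi.
  have -> : c = Defs.col f i :> nat by rewrite /Defs.col -fi.
  rewrite rk -nth_row_word -[X in _ < row_count X _]take_size.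
  by apply: row_count_take_lt; rewrite size_row_word.
move=> /row_count_occurrence[t]; rewrite size_row_word => tn.
rewrite -[t]/(val (Ordinal tn)) nth_row_word => -[rt ct].
exists (Ordinal tn); first exact: mem_set.
rewrite [RHS]surjective_pairing; congr (_, _); apply: val_inj => //=.
by rewrite -[LHS]ct -rt -rk.
Qed.

Lemma shape_row_count n (f g : filling n) : ranked f -> ranked g ->
  (Defs.shape f == Defs.shape g) <-> row_count (row_word f) = row_count (row_word g).
Proof.
move=> rf rg; split=> [/eqP fg|fg]; last first.
  by apply/eqP/setP => -[r c]; rewrite !mem_shape // fg.
apply/funext => r; have [nr|rn] := leqP n r.
  by rewrite !(@row_count_gt n) ?row_word_bounded.
have le (h : filling n) : row_count (row_word h) r <= n.
  by rewrite -[X in _ <= X](size_row_word h); exact: count_size.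
have lt (f' g' : filling n) : ranked f' -> ranked g' ->
    Defs.shape f' = Defs.shape g' -> row_count (row_word f') r <= row_count (row_word g') r.
  move=> rf' rg' fg'; rewrite leqNgt; apply/negP => lt.
  (* The witness is the first cell of row [r] outside [g'], which would lie in [f']. *)
  have := mem_shape (Ordinal rn) (Ordinal (leq_trans lt (le f'))).
  by move=> ms; have := ms g' rg'; rewrite -fg' ms //= lt ltnn.
by apply/eqP; rewrite eqn_leq !lt.
Qed.

Lemma containsE n k (U : filling n) (T : filling k) : is_syt U -> is_syt T ->
  contains U T = (k <= n) && (take k (row_word U) == row_word T).
Proof.
move=> /syt_lattice[_ rU] /syt_lattice[_ rT]; rewrite /contains.
case: (leqP k n) => //= kn; apply/forallP/eqP => [UT|UT i].
  apply: (@eq_from_nth _ 0); first by rewrite size_takel !size_row_word.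
  move=> t; rewrite size_takel ?size_row_word // => tk.
  have tn := leq_trans tk kn; rewrite nth_take //.
  have /forallP/(_ (Ordinal tk)) := UT (Ordinal tn).
  by rewrite eqxx -!nth_row_word => /andP[/eqP].
apply/forallP => j; apply/implyP => /eqP ij.
have r : Defs.row U i = Defs.row T j.
  by rewrite -!nth_row_word -UT nth_take // ij.
rewrite rU rT r -UT take_takel ?ij ?eqxx //; exact: ltnW.
Qed.

(** * Tableau counts as walk counts *)

Lemma card_seq (I : finType) (X : eqType) (A : {set I}) (phi : I -> X) (s : seq X) :
    {in A &, injective phi} -> uniq s ->
    (forall x, x \in s <-> exists2 a, a \in A & phi a = x) ->
  #|A| = size s.
Proof.
move=> phi_inj s_uniq sP; rewrite cardE -(size_map phi).
apply/perm_size/uniq_perm => //.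
  by rewrite map_inj_in_uniq ?enum_uniq // => a b; rewrite !mem_enum; exact: phi_inj.
move=> x; apply/mapP/idP => [[a + ->]|/sP[a aA <-]].
  by rewrite mem_enum => aA; apply/sP; exists a.
by exists a; rewrite ?mem_enum.
Qed.

(** The letters after the first [k] of a row word form an upward walk from the shape of [T], and any
    such walk extends [T]. *)
Lemma Ncount_up_count k (T : filling k) n : is_syt T -> k <= n ->
  Ncount T n = up_count n (n - k) (row_count (row_word T)).
Proof.
move=> sT kn; have [lT rT] := syt_lattice sT.
apply: (@card_seq _ _ _ (fun U => drop k (row_word U))); [|exact: uniq_walks|].
  move=> U V; rewrite !inE => /andP[sU +] /andP[sV +] UV.
  rewrite !containsE // kn /= => /eqP UT /eqP VT; apply: row_word_inj => //.
  by rewrite -(cat_take_drop k (row_word U)) UT UV -VT cat_take_drop.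
move=> w; rewrite mem_walks; split=> [/and3P[/eqP sw wn ww]|[U]].
  have sz : size (row_word T ++ w) = n by rewrite size_cat size_row_word sw subnKC.
  have bd : all (fun i => i < n) (row_word T ++ w).
    rewrite all_cat wn andbT; apply: sub_all (row_word_bounded T) => i.
    by move=> /= /leq_trans; exact.
  have lt : lattice (row_word T ++ w).
    by rewrite /lattice walk_cat foldl_add_cell -/(lattice _) lT.
  have sU := filling_of_syt sz bd lt.
  exists (filling_of n (row_word T ++ w)).
    rewrite inE sU containsE // kn row_word_filling_of //= take_size_cat ?size_row_word //.
  by rewrite row_word_filling_of // drop_size_cat ?size_row_word.
rewrite inE => /andP[sU]; rewrite containsE // kn /= => /eqP UT <-.
have [+ _] := syt_lattice sU; rewrite /lattice -{1}(cat_take_drop k (row_word U)) UT.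
rewrite walk_cat foldl_add_cell => /andP[_ ->]; rewrite size_drop size_row_word eqxx.
rewrite andbT /=; have := row_word_bounded U.
by rewrite -{1}(cat_take_drop k (row_word U)) all_cat => /andP[].
Qed.

(** Reversed row words of tableaux of the given shape are exactly the complete downward walks from
    it. *)
Lemma flambda_down_count k (T : filling k) : is_syt T ->
  flambda T = down_count k k (row_count (row_word T)).
Proof.
move=> sT; have [lT rT] := syt_lattice sT.
have bT i : k <= i -> row_count (row_word T) i = 0 by apply: row_count_gt; exact: row_word_bounded.
have downT w : size w = k -> walk removable del_cell (row_count (row_word T)) (rev w) <->
    lattice w /\ row_count w = row_count (row_word T).
  move=> sw; apply: (@walk_down_rev k) => //; first exact: partition_row_count.
  by rewrite sum_row_count ?row_word_bounded // size_row_word.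
apply: (@card_seq _ _ _ (fun S => rev (row_word S))); [|exact: uniq_walks|].
  move=> U V; rewrite !inE => /andP[sU _] /andP[sV _] /(can_inj revK).
  exact: row_word_inj.
move=> w; rewrite mem_walks; split=> [/and3P[/eqP sw wn ww]|[S]].
  have := ww; rewrite -{1}[w]revK downT ?size_rev // => -[lw cw].
  have sz : size (rev w) = k by rewrite size_rev.
  have bd : all (fun i => i < k) (rev w) by rewrite all_rev.
  have sS := filling_of_syt sz bd lw.
  exists (filling_of k (rev w)); last by rewrite row_word_filling_of // revK.
  rewrite inE sS; apply/shape_row_count => //; last by rewrite row_word_filling_of.
  exact: filling_of_ranked.
rewrite inE => /andP[sS]; have [lS rS] := syt_lattice sS.
move=> /(shape_row_count rS rT) cS <-.
rewrite size_rev size_row_word eqxx all_rev row_word_bounded /=.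
by apply/downT; rewrite ?size_row_word.
Qed.

(** The shape has [k] cells, so [p = k.+1] suffices, and [k] rows at most, so the downward walks can
    be bounded independently of [n]. *)
Lemma NcountE k (T : filling k) n : is_syt T -> k <= n ->
  Ncount T n = \sum_(j < k.+1)
    'C(n - k, j) * involutions (n - k - j) * down_count k j (row_count (row_word T)).
Proof.
move=> sT kn; have [lT rT] := syt_lattice sT.
have bT b i : k <= b -> b <= i -> row_count (row_word T) i = 0.
  by move=> kb bi; apply: (@row_count_gt k); [exact: row_word_bounded|exact: leq_trans bi].
rewrite Ncount_up_count // (@up_countE _ _ _ k.+1) ?leq_subr //.
- by apply: eq_bigr => j _; rewrite (@down_count_widen k n) // => i; exact: bT.
- exact: partition_row_count.
- by move=> i ni; apply: (bT k) => //; lia.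
rewrite sum_row_count ?size_row_word //; apply: sub_all (row_word_bounded T) => i.
by move=> /= /leq_trans; exact.
Qed.

Lemma tcount_involutions n : tcount n = involutions n.
Proof.
have [T sT] : exists T : filling 0, is_syt T.
  exists [ffun i => (i, i)]; apply/and4P; split; try by apply/forallP => -[].
  by apply/injectiveP => -[].
(* Every tableau contains the empty one, for which only the term [j = 0] remains. *)
transitivity (Ncount T n).
  apply: eq_card => U; rewrite !inE /contains /= andbC.
  by have -> : [forall i : 'I_n, forall j : 'I_0, (i == j :> nat) ==>
      (Defs.row U i == Defs.row T j) && (Defs.col U i == Defs.col T j)]
    by apply/forallP => i; apply/forallP => -[].
by rewrite NcountE // big_ord1 !subn0 bin0 mul1n muln1.
Qed.

(** * Growth of the involution numbers *)

Lemma involutions_gt0 n : 0 < involutions n.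
Proof. by elim: n => // n IH; rewrite involutionsS addn_gt0 IH. Qed.

Local Open Scope classical_set_scope.
Local Open Scope ring_scope.

Section Asymptotics.
Variable R : realType.
Let t n : R := (involutions n)%:R.

Let t_gt0 n : 0 < t n.
Proof. by rewrite ltr0n involutions_gt0. Qed.

Let t_neq0 n : t n != 0.
Proof. by rewrite gt_eqF. Qed.

Let tSS n : t n.+2 = t n.+1 + n.+1%:R * t n.
Proof. by rewrite /t involutionsS natrD natrM. Qed.

(* The two bounds must be carried together: as t_(n+2) = t_(n+1) + (n+1) t_n,
   each one at n+1 follows from the other at n.  They say that
   sqrt(n+1) <= t_(n+1) / t_n <= 1 + sqrt(n+1). *)
Lemma involutions_growth n :
  n.+1%:R * t n ^+ 2 <= t n.+1 ^+ 2 /\ (t n.+1 - t n) ^+ 2 <= n.+1%:R * t n ^+ 2.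
Proof.
elim: n => [|n [lo hi]]; first by rewrite /t /involutions /=; split; lra.
have N0 : 0 <= n.+1%:R :> R by [].
rewrite tSS -(natr1 n.+1); have := t_gt0 n; have := t_gt0 n.+1.
set N : R := n.+1%:R in lo hi N0 *.
move: (t n) (t n.+1) lo hi => a b lo hi b0 a0; split.
  rewrite -subr_ge0.
  have -> : (b + N * a) ^+ 2 - (N + 1) * b ^+ 2 =
     N * (N * a ^+ 2 - (b - a) ^+ 2 + a ^+ 2) by ring.
  by rewrite mulr_ge0 // addr_ge0 ?subr_ge0 ?sqr_ge0.
rewrite addrC addKr exprMn expr2 -mulrA.
apply: (@le_trans _ _ (N * b ^+ 2)); first exact: ler_wpM2l.
by rewrite ler_wpM2r ?sqr_ge0 // lerDl.
Qed.

(** The lower growth bound makes the squared ratio at most 1/(n+1); working with squares avoids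
    roots. *)
Lemma involutions_ratio0 : (fun n => t n / t n.+1) @ \oo --> (0 : R).
Proof.
apply/cvgr0Pnorm_le => e e0; near=> n.
have q0 : 0 <= t n / t n.+1 by rewrite divr_ge0 // ltW.
rewrite ger0_norm // -(@ler_pXn2r _ 2) ?nnegrE ?(ltW e0) //.
rewrite expr_div_n ler_pdivrMr ?exprn_gt0 //.
have [+ _] := involutions_growth n.
move=> /(ler_wpM2l (sqr_ge0 e)); apply: le_trans.
rewrite mulrA ler_peMl ?sqr_ge0 // -ler_pdivrMl ?exprn_gt0 // mulr1.
apply: (@le_trans _ _ n%:R); last by rewrite ler_nat.
by near: n; exact: nbhs_infty_ger.
Unshelve. all: by end_near. Qed.

Lemma involutions_ratio d :
  (fun n => t n / t (n + d)) @ \oo --> ((d == 0)%N%:R : R).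
Proof.
elim: d => [|d IH].
  by under eq_fun do rewrite addn0 divff //; exact: cvg_cst.
have -> : (d.+1 == 0)%N%:R = (d == 0)%N%:R * 0 :> R by rewrite mulr0.
have -> : (fun n => t n / t (n + d.+1)) =
    (fun n => (t n / t (n + d)) * (t (n + d) / t (n + d).+1)).
  by apply/funext => n; rewrite addnS mulrA divfK.
apply: cvgM => //.
by have := involutions_ratio0; rewrite -(cvg_shiftn d).
Qed.

Lemma involutions_ratio2 : (fun n => n.+1%:R * t n / t n.+2) @ \oo --> (1 : R).
Proof.
have -> : (fun n => n.+1%:R * t n / t n.+2) = (fun n => 1 - t n.+1 / t n.+2).
  apply/funext => n; rewrite -[X in X - _](divff (t_neq0 n.+2)) -mulrBl {2}tSS.
  by rewrite addrAC subrr add0r.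
rewrite -[X in _ --> X]subr0; apply: cvgB; first exact: cvg_cst.
by have := involutions_ratio0; rewrite -(cvg_shiftn 1); under eq_fun do rewrite addn1.
Qed.

Lemma cvg_ratio_shift (a b : nat) :
  (fun n => (n + a).+1%:R / (n + b).+1%:R) @ \oo --> (1 : R).
Proof.
have h c : (fun n => c%:R / (n + b).+1%:R) @ \oo --> (0 : R).
  rewrite -[X in _ --> X](mulr0 c%:R); apply: cvgM; first exact: cvg_cst.
  by have := @cvg_harmonic R; rewrite -(cvg_shiftn b).
have -> : (fun n => (n + a).+1%:R / (n + b).+1%:R) =
    (fun n => 1 + a%:R / (n + b).+1%:R - b%:R / (n + b).+1%:R) :> (nat -> R).
  apply/funext => n.
  have N0 : (n + b).+1%:R != 0 :> R by [].
  rewrite -[X in X + _ - _](divff N0) -mulrDl -mulrBl; congr (_ / _).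
  by rewrite -!natr1 !natrD; ring.
rewrite -[X in _ --> X](subr0) -[in X in _ --> X](addr0 1).
by apply: cvgB => //; apply: cvgD => //; exact: cvg_cst.
Qed.

(** Each increment of [j] multiplies by a shifted instance of [involutions_ratio2], corrected by
    (n+j+1)/(n+2j+1), which tends to 1. *)
Lemma ffact_involutions j :
  (fun n => ((n + j) ^_ j)%:R * t n / t (n + j.*2)) @ \oo --> (1 : R).
Proof.
elim: j => [|j IH].
  by under eq_fun do rewrite ffactn0 mul1r addn0 divff //; exact: cvg_cst.
have -> : (fun n => ((n + j.+1) ^_ j.+1)%:R * t n / t (n + j.+1.*2)) =
    (fun n => (((n + j) ^_ j)%:R * t n / t (n + j.*2)) *
      (((n + j.*2).+1%:R * t (n + j.*2) / t (n + j.*2).+2) *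
       ((n + j).+1%:R / (n + j.*2).+1%:R))).
  apply/funext => n; rewrite doubleS !addnS ffactSS natrM.
  field.
  by rewrite !t_neq0 /= -natrD nat1r andbT.
rewrite -[X in _ --> X]mul1r; apply: cvgM => //.
rewrite -[X in _ --> X]mul1r; apply: cvgM; last exact: cvg_ratio_shift.
by have := involutions_ratio2; rewrite -(cvg_shiftn j.*2).
Qed.

(** After shifting [n] by [j], the denominator is [t] at n+2j+(k-j): n+2j balances the falling
    factorial, and the surplus k-j sends the quotient to 0 unless [j = k]. *)
Lemma bin_involutions j k : (j <= k)%N ->
  (fun n => ('C(n, j) * involutions (n - j))%:R / t (n + k)) @ \oo -->
    ((j == k)%N%:R / k`!%:R : R).
Proof.
move=> jk; rewrite -(cvg_shiftn j).
have -> : (fun n => ('C(n + j, j) * involutions (n + j - j))%:R / t (n + j + k)) =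
    (fun n => (((n + j) ^_ j)%:R * t n / t (n + j.*2)) *
       (t (n + j.*2) / t (n + j.*2 + (k - j))) / j`!%:R).
  apply/funext => n; rewrite addnK -bin_ffact !natrM -/(t n).
  have -> : (n + j.*2 + (k - j) = n + j + k)%N by lia.
  by field; rewrite !t_neq0 pnatr_eq0 -lt0n fact_gt0.
have -> : (j == k)%N%:R / k`!%:R = 1 * ((k - j == 0)%N%:R) / j`!%:R :> R.
  by rewrite mul1r subn_eq0 eqn_leq jk /=; case: leqP => kj; rewrite ?mul0r //;
     have -> : j = k by lia.
apply: cvgM; last exact: cvg_cst.
apply: cvgM; first exact: ffact_involutions.
by have := @involutions_ratio (k - j); rewrite -(cvg_shiftn j.*2).
Qed.

End Asymptotics.

Theorem theorem1 (R : realType) (k : nat) (T : filling k) :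
  is_syt T ->
  (fun n : nat => ((Ncount T n)%:R / (tcount n)%:R : R)) @ \oo -->
    ((flambda T)%:R / (k`!)%:R : R).
Proof.
move=> sT; rewrite -(cvg_shiftn k) flambda_down_count //.
set d := fun j => down_count k j (row_count (row_word T)).
have -> : (fun n => (Ncount T (n + k))%:R / (tcount (n + k))%:R) =
    (fun n => \sum_(j < k.+1)
       ('C(n, j) * involutions (n - j))%:R / (involutions (n + k))%:R * (d j)%:R)
    :> (nat -> R).
  apply/funext => n; rewrite tcount_involutions NcountE ?leq_addl // addnK.
  rewrite natr_sum big_distrl /=; apply: eq_bigr => j _.
  by rewrite natrM mulrAC.
(* The limit is padded with zero terms so that the two sums can be compared term by term. *)
have -> : (d k)%:R / k`!%:R =
    \sum_(j < k.+1) ((j == k :> nat)%:R / k`!%:R) * (d j)%:R :> R.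
  rewrite big_ord_recr /= eqxx big1 => [|j _]; first by rewrite add0r mul1r mulrC.
  by rewrite (ltn_eqF (ltn_ord j)) !mul0r.
apply: (@cvg_big R _ +%R 0 xpredT (@add_continuous R)) => j _.
apply: cvgM; last exact: cvg_cst.
by apply: bin_involutions; rewrite -ltnS.
Qed.
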